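(* Let $E$ be a Euclidean space of finite dimension $n\ge2$ and let $r>0$. (a) A compact convex subset $C$ of $E$ is $r$-maximal if and only if it has constant diameter $r$. (b) Let $C$ be an $r$-maximal subset of $E$. If $x\in C$ and $y_1\ne y_2$ are two points of $C$ with $|x-y_1|=|x-y_2|=r$, then the arc between $y_1$ and $y_2$ with center $x$ is entirely contained in the boundary of $C$. Conversely, if an arc of radius $r$ with center $x$ (between two distinct points $y_1,y_2$) is contained in the boundary of $C$, then $x$ lies in the boundary of $C$, and for each point $y$ of the arc other than its endpoints $y_1,y_2$, $x$ is the unique point of $C$ at distance $r$ from $y$.
   Context: A Euclidean space is a finite-dimensional real linear space with norm $|\cdot|$ obtained from an inner product, with metric $d(x,y)=|x-y|$. A subset of $E$ is $r$-bounded if its diameter is at most $r$; it is $r$-maximal if it is maximal (with respect to inclusion) among the $r$-bounded subsets of $E$. $C$ has constant diameter $r$ if $\sup\{\omega(x_1-x_2):x_1,x_2\in C\}=r$ for every $\omega$ in the unit sphere of the dual space $E^*$ (with the dual norm). Arcs: for distinct points $y_1,y_2\in E$ and $x\in E$ with $|x-y_1|=|x-y_2|=\rho>0$, the arc between $y_1$ and $y_2$ with center $x$ (and radius $\rho$) is the smaller of the two closed arcs with endpoints $y_1,y_2$ of the circle of radius $\rho$ centered at $x$ through $y_1$ and $y_2$ (in the plane containing $x,y_1,y_2$). If $x$ is the midpoint of the segment $[y_1,y_2]$, any semicircle centered at $x$ with endpoints $y_1,y_2$ counts as such an arc. *)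

(* Defs.v *)
From HB Require Import structures.
From mathcomp Require Import all_boot all_order all_algebra.
From mathcomp Require Import sesquilinear.
From mathcomp Require Import all_classical all_reals all_analysis.

Set Implicit Arguments.
Unset Strict Implicit.
Unset Printing Implicit Defensive.

Import Order.TTheory GRing.Theory Num.Theory.
Import numFieldNormedType.Exports.

Local Open Scope classical_set_scope.
Local Open Scope ring_scope.

(* A finite-dimensional real normed space whose norm comes from an inner
   product; its topology is the one of the normed module, i.e. that of the
   metric d(x, y) = |x - y|. *)
HB.mixin Record NormedVector_isEuclidean (R : realType) E
    & NormedModule R E & Vector R E := {
  dotp : {dot E for (@idfun R)};
  norm_dotp : forall x : E, `|x| = Num.sqrt (dotp x x)
}.

#[short(type="euclideanType")]
HB.structure Definition Euclidean (R : realType) :=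
  {E of NormedModule R E & Vector R E & NormedVector_isEuclidean R E}.

Section Diameter.
Context {R : realType} {E : euclideanType R}.
Implicit Types (A B C : set E) (r : R).

(* The supremum is taken in \bar R: it is -oo for the empty set, which is
   therefore r-bounded for every r, and +oo for an unbounded set. *)
Definition diameter A : \bar R :=
  ereal_sup [set (`|p.1 - p.2|)%:E | p in A `*` A].

Definition r_bounded r A := (diameter A <= r%:E)%E.

Definition r_maximal r A :=
  r_bounded r A /\ forall B, r_bounded r B -> A `<=` B -> B = A.

Definition boundary A := closure A `\` A°.

(* Since E is finite-dimensional, its dual consists of all the linear forms. *)
Definition dual_norm (omega : {linear E -> R^o}) : \bar R :=
  ereal_sup [set (`|omega x|)%:E | x in [set x : E | `|x| <= 1]].

Definition constant_diameter r C :=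
  forall omega : {linear E -> R^o}, dual_norm omega = 1%E ->
    ereal_sup [set (omega (p.1 - p.2))%:E | p in C `*` C] = r%:E.

End Diameter.

Section Arcs.
Context {R : realType} {E : euclideanType R}.
Implicit Types (x y u v : E) (rho theta : R).

(* For u, v orthonormal, [circle_point x rho u v] runs over the circle of
   center x and radius rho in the plane x + span(u, v). *)
Definition circle_point x rho u v (t : R) : E :=
  x + rho *: (cos t *: u + sin t *: v).

(* [is_arc x rho y1 y2 A]: A is the arc (an arc, if x is the midpoint of
   [y1, y2]) between y1 and y2 with center x and radius rho.  The frame (u, v)
   is oriented so that A is run through from y1 (angle 0) to y2 (angle theta);
   theta and 2 pi - theta are the angles of the two closed arcs with endpoints
   y1 and y2, so that A is the smaller one.  When theta = pi, any unit v
   orthogonal to u is allowed: every semicircle counts. *)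
Definition is_arc x rho y1 y2 (A : set E) :=
  exists u v theta,
    [/\ [/\ dotp u u = 1, dotp v v = 1 & dotp u v = 0],
        0 < theta <= 2 * pi - theta,
        y1 = circle_point x rho u v 0,
        y2 = circle_point x rho u v theta &
        A = circle_point x rho u v @` `[0, theta]].

End Arcs.

(* Main.v *)
Require Import Defs.
From HB Require Import structures.
From mathcomp Require Import all_boot all_order all_algebra.
From mathcomp Require Import sesquilinear.
From mathcomp Require Import all_classical all_reals all_analysis.
From mathcomp Require Import ring lra.

Import Order.TTheory GRing.Theory Num.Theory.
Import numFieldNormedType.Exports.

Local Open Scope classical_set_scope.
Local Open Scope ring_scope.

(** Everything rests on one estimate. Put the center of an arc of radius [r] at
    the origin. If the arc between [y1] and [y2] is shorter than a semicircle,
    a point [z] of it is [a y1 + b y2] with [a, b >= 0] and [a + b >= 1], and a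
    point [w] is within [r] of [yi] iff [|w|^2 <= 2 <w, yi>]. Taking the
    combination of these two inequalities with coefficients [a] and [b] gives
      [|w - z|^2 + (a + b - 1) |w|^2 <= r^2]   (lemma [arc_dist]),
    so a ball of radius [r] that contains the two ends of the arc contains the
    arc ([ball_hull_arc]), and when [a + b > 1] only the center of the arc can
    be at distance [r] from [z].

    An [r]-maximal set contains every point that is within [r] of all of its
    points ([r_maximal_mem]). It therefore contains all the minor arcs of
    radius [r] between two of its points; since a point at distance [r] from
    another point of the set is in the boundary, this is the first half of
    (b). For the second half, let [y] be inside an arc contained in the
    boundary. Since [y] is not interior, the set has points [w] with
    [|w - y|] arbitrarily close to [r]; the estimate forces them to converge to
    the center [x], which is thus in the (closed) set, and the same estimate
    gives uniqueness.

    For (a), let [C] be compact and [r]-maximal, and let [p] maximize a unit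
    linear form [<u, .>] on [C]. Then [p - r u] is in [C], which gives a pair
    of points realizing the width [r] in the direction [u]. Indeed, if some
    [c] in [C] were at distance more than [r] from [p - r u], then the arc of
    radius [r] between [p] and [c] that bulges towards [u] would rise above
    [p] ([arc_bulge]), and it is contained in [C]. Conversely, if [C] has
    constant diameter [r] and [b] is outside [C], let [p] be the point of [C]
    nearest to [b], and [u] the direction of [b - p]. Two points [x, y] of [C]
    with [<u, x - y>] close to [r] give [<u, b - y> > r], because [p] is
    highest in [C] in the direction [u]; hence [b] cannot be added to [C]. *)

(** * The inner product, its dual norm, and the Riesz representation *)

Local Notation "''[' u , v ]" := (dotp u v) : ring_scope.

Section InnerProduct.
Context {R : realType} {E : euclideanType R}.
Implicit Types u v w x y z : E.

Lemma dotC u v : '[u, v] = '[v, u].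
Proof. by rewrite hermC /= expr0 mul1r. Qed.

Lemma dotDr u v w : '[u, v + w] = '[u, v] + '[u, w].
Proof. exact: linearDr. Qed.

Lemma dotDl u v w : '[v + w, u] = '[v, u] + '[w, u].
Proof. exact: linearDl. Qed.

Lemma dotNr u v : '[u, - v] = - '[u, v].
Proof. exact: linearNr. Qed.

Lemma dotNl u v : '[- u, v] = - '[u, v].
Proof. exact: linearNl. Qed.

Lemma dotZr a u v : '[u, a *: v] = a * '[u, v].
Proof. exact: linearZr_LR. Qed.

Lemma dotZl a u v : '[a *: u, v] = a * '[u, v].
Proof. exact: linearZl_LR. Qed.

Definition dotE := (dotDr, dotDl, dotNr, dotNl, dotZr, dotZl).

Lemma dot_gt0 u : u != 0 -> 0 < '[u, u].
Proof. exact: neq0_dnorm_gt0. Qed.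

Lemma sqr_norm u : `|u| ^+ 2 = '[u, u].
Proof.
rewrite norm_dotp sqr_sqrtr //; have [->|] := eqVneq u 0.
  by rewrite linear0r.
by move/dot_gt0/ltW.
Qed.

Lemma norm_le_dot u (a : R) : 0 <= a -> (`|u| <= a) = ('[u, u] <= a ^+ 2).
Proof. by move=> a0; rewrite -sqr_norm ler_sqr ?nnegrE. Qed.

Lemma norm_eq_dot u (a : R) : 0 <= a -> '[u, u] = a ^+ 2 -> `|u| = a.
Proof. by move=> a0 e; rewrite norm_dotp e sqrtr_sqr ger0_norm. Qed.

Lemma dot_le_norm u v : '[u, v] <= `|u| * `|v|.
Proof.
have : `|u + v| ^+ 2 <= (`|u| + `|v|) ^+ 2.
  by rewrite ler_sqr ?nnegrE ?addr_ge0 // ler_normD.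
rewrite sqrrD !sqr_norm !dotE (dotC v u).
lra.
Qed.

(** The inner product gives an injective linear map from [E] to its dual, and
    both spaces have the same dimension. *)
Lemma riesz (omega : {linear E -> R^o}) :
  exists u, forall x, omega x = '[u, x].
Proof.
have lin : linear (fun u => linfun (dotp u : {linear E -> R^o})).
  move=> a u v; apply/lfunP => x.
  by rewrite !lfunE /= !lfunE /= !lfunE /= !dotE.
pose flin := GRing.isLinear.Build R E 'Hom(E, R^o) *:%R _ lin.
pose F : {linear E -> 'Hom(E, R^o)} :=
  HB.pack (fun u => linfun (dotp u : {linear E -> R^o})) flin.
have kerF : lker (linfun F) == 0%VS.
  rewrite -subv0; apply/subvP => u; rewrite memv_ker memv0 lfunE /= => /eqP Fu.
  have := lfunE (dotp u : {linear E -> R^o}) u.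
  rewrite Fu lfunE /= => /esym/eqP.
  by apply: contraLR => /dot_gt0/lt0r_neq0.
have : linfun omega \in limg (linfun F).
  suff -> : limg (linfun F) = fullv by exact: memvf.
  apply/eqP; rewrite eqEdim subvf limg_dim_eq; last by rewrite (eqP kerF) capv0.
  by rewrite !dimvf /dim /= muln1.
case/memv_imgP => u _ eq_omega; exists u => x.
by rewrite -(lfunE omega) eq_omega lfunE /= lfunE.
Qed.

Lemma dual_norm_dot (omega : {linear E -> R^o}) u :
  (forall x, omega x = '[u, x]) -> dual_norm omega = `|u|%:E.
Proof.
move=> omegaE; apply/eqP; rewrite eq_le; apply/andP; split.
  apply: ge_ereal_sup => _ [x /= x1 <-]; rewrite lee_fin omegaE.
  have := ler_wpM2l (normr_ge0 u) x1; rewrite mulr1; apply: le_trans.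
  rewrite ler_norml dot_le_norm andbT lerNl -dotNr.
  by rewrite (le_trans (dot_le_norm _ _)) // normrN.
have [->|u0] := eqVneq u 0.
  rewrite normr0; apply: ereal_sup_ubound.
  by exists 0; rewrite /= ?normr0 ?ler01 // linear0 normr0.
apply: ereal_sup_ubound; exists (`|u|^-1 *: u) => /=.
  by rewrite normrZ normfV normr_id mulVf ?normr_eq0.
rewrite omegaE dotZr -sqr_norm expr2 mulrA mulVf ?normr_eq0 // mul1r.
by rewrite normr_id.
Qed.

End InnerProduct.

(** * Arcs and balls of the same radius *)

Section Arc.
Context {R : realType} {E : euclideanType R}.
Implicit Types (u v w x y z c m : E) (r a b t : R).

(** The term [(a + b - 1) |w|^2] is what makes distances to inner points of the
    arc smaller than [r], in a quantitative way, for all [w] except the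
    center. *)
Lemma arc_dist r y1 y2 z w a b : `|y1| = r -> `|y2| = r -> `|z| = r ->
  z = a *: y1 + b *: y2 -> 0 <= a -> 0 <= b ->
  `|w - y1| <= r -> `|w - y2| <= r ->
  `|w - z| ^+ 2 + (a + b - 1) * `|w| ^+ 2 <= r ^+ 2.
Proof.
move=> y1r y2r zr zE a0 b0 w1 w2.
have half y : `|y| = r -> `|w - y| <= r -> '[w, w] <= 2 * '[w, y].
  move=> <-; rewrite norm_le_dot // sqr_norm !dotE (dotC y w); lra.
have := ler_wpM2l a0 (half _ y1r w1); have := ler_wpM2l b0 (half _ y2r w2).
have wz : '[w, z] = a * '[w, y1] + b * '[w, y2] by rewrite zE !dotE.
rewrite -zr !sqr_norm !dotE (dotC z w) wz; lra.
Qed.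

Lemma arc_coef_ge1 r y1 y2 z a b : 0 < r -> `|y1| = r -> `|y2| = r ->
  `|z| = r -> z = a *: y1 + b *: y2 -> 0 <= a -> 0 <= b -> 1 <= a + b.
Proof.
move=> r0 y1r y2r zr zE a0 b0.
rewrite -(ler_pM2r r0) mul1r mulrDl -{1}zr zE (le_trans (ler_normD _ _)) //.
by rewrite !normrZ !ger0_norm // y1r y2r.
Qed.

(** The sphere is strictly convex: a proper combination of two distinct points
    of the sphere must be dilated to lie on the sphere again. *)
Lemma arc_coef_gt1 r y1 y2 z a b : 0 < r -> `|y1| = r -> `|y2| = r ->
  `|z| = r -> z = a *: y1 + b *: y2 -> 0 < a -> 0 < b -> y1 != y2 ->
  1 < a + b.
Proof.
move=> r0 y1r y2r zr zE a0 b0 y12.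
have y12r : '[y1, y2] < r ^+ 2.
  have : 0 < '[y1 - y2, y1 - y2] by rewrite dot_gt0 // subr_eq0.
  rewrite !dotE (dotC y2 y1) -!sqr_norm y1r y2r; lra.
have zz : r ^+ 2 < ((a + b) * r) ^+ 2.
  have := ltr_pM2l (mulr_gt0 a0 b0) '[y1, y2] (r ^+ 2); rewrite y12r => ab.
  rewrite -{1}zr sqr_norm zE !dotE (dotC y2 y1) -!sqr_norm y1r y2r; lra.
rewrite -(ltr_pM2r r0) mul1r -ltr_sqr ?nnegrE ?ltW //.
by rewrite mulr_gt0 // addr_gt0.
Qed.

Lemma ball_hull_arc r y1 y2 z w a b : 0 < r -> `|y1| = r -> `|y2| = r ->
  `|z| = r -> z = a *: y1 + b *: y2 -> 0 <= a -> 0 <= b ->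
  `|w - y1| <= r -> `|w - y2| <= r -> `|w - z| <= r.
Proof.
move=> r0 y1r y2r zr zE a0 b0 w1 w2.
have ab := arc_coef_ge1 _ _ _ _ _ _ r0 y1r y2r zr zE a0 b0.
rewrite -ler_sqr ?nnegrE ?(ltW r0) //.
apply: le_trans (arc_dist _ _ _ _ _ _ _ y1r y2r zr zE a0 b0 w1 w2).
rewrite lerDl mulr_ge0 ?sqr_ge0 //; lra.
Qed.

(** Among the arcs of radius [r] between [0] and [c], take the one on the side
    of [u] in the plane of [u] and [c], and let [m] be its center; the witness
    is its highest point [z = m + r u] in the direction [u]. Since [c] is not
    above [0] but is at distance more than [r] from [- r u], the point [z] lies
    between [0] and [c] on this arc, and [m] is not [- r u], so that
    [<u, z> > 0]. *)
Lemma arc_bulge r u c : 0 < r -> `|u| = 1 -> '[u, c] <= 0 -> `|c| <= r ->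
  r < `|r *: u + c| ->
  exists2 z, 0 < '[u, z] &
    forall w, `|w| <= r -> `|w - c| <= r -> `|w - z| <= r.
Proof.
move=> r0 u1 uc0 cr rc.
have uu : '[u, u] = 1 by rewrite -sqr_norm u1 expr1n.
have far : 0 < 2 * r * '[u, c] + '[c, c].
  have : r ^+ 2 < `|r *: u + c| ^+ 2 by rewrite ltr_sqr ?nnegrE ?(ltW r0).
  rewrite sqr_norm !dotE uu (dotC c u); lra.
have cc0 : 0 < '[c, c] by have := mulr_ge0_le0 (ltW r0) uc0; lra.
have ccr : '[c, c] <= r ^+ 2 by rewrite -norm_le_dot // ltW.
(* The decomposition [u = s c + e] with [e] orthogonal to [c] and [|e| = t];
   the center [m] is at distance [h] from the chord, opposite to [e]. *)
have [s sE] : exists s, '[u, c] = s * '[c, c].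
  by exists ('[u, c] / '[c, c]); rewrite mulfVK // gt_eqF.
have s0 : s <= 0 by rewrite -(pmulr_lle0 _ cc0) -sE.
have sr : 0 < 2 * r * s + 1.
  rewrite -(pmulr_lgt0 _ cc0); move: far; rewrite sE; lra.
have rs2 : 4 * (r * s) ^+ 2 < 1.
  have rs0 : r * s <= 0 by rewrite mulr_ge0_le0 // ltW.
  nra.
have h20 : 0 < r ^+ 2 - '[c, c] / 4 by have := exprn_gt0 2 r0; lra.
have t20 : 4 * s ^+ 2 * (r ^+ 2 - '[c, c] / 4) < 1 - s ^+ 2 * '[c, c] by lra.
pose h := Num.sqrt (r ^+ 2 - '[c, c] / 4).
pose t := Num.sqrt (1 - s ^+ 2 * '[c, c]).
have h2 : h ^+ 2 = r ^+ 2 - '[c, c] / 4 by rewrite sqr_sqrtr // ltW.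
have t2' : 0 < 1 - s ^+ 2 * '[c, c].
  apply: le_lt_trans t20; apply: mulr_ge0 (ltW h20).
  by rewrite mulr_ge0 ?sqr_ge0.
have t2 : t ^+ 2 = 1 - s ^+ 2 * '[c, c] by rewrite sqr_sqrtr // ltW.
have h0 : 0 < h by rewrite sqrtr_gt0.
have t0 : 0 < t by rewrite sqrtr_gt0.
(* This inequality says that the coefficient of [c - m] in the expression of
   [r u] below is nonnegative, i.e. that [z] does not lie beyond [c]. *)
have th : - (2 * s * h) <= t.
  have sh : 0 <= - (2 * s * h) by have := mulr_le0_ge0 s0 (ltW h0); lra.
  apply: ltW; rewrite -ltr_sqr ?nnegrE ?(ltW t0) //.
  rewrite t2 sqrrN !exprMn h2; move: t20. lra.
have [e eE] : exists e, e = u - s *: c by eexists.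
have ec : '[c, e] = 0 by rewrite eE !dotE (dotC c u) sE subrr.
have ee : '[e, e] = t ^+ 2 by rewrite t2 eE !dotE uu (dotC c u) sE; ring.
pose k := h / t.
have kt : k ^+ 2 * t ^+ 2 = h ^+ 2.
  by rewrite -exprMn divfK // gt_eqF.
pose m := 2^-1 *: c - k *: e.
have mr : `|- m| = r.
  apply: norm_eq_dot; first exact: ltW.
  by rewrite /m !dotE (dotC e c) ec ee; lra.
have cmr : `|c - m| = r.
  apply: norm_eq_dot; first exact: ltW.
  by rewrite /m !dotE (dotC e c) ec ee; lra.
have rur : `|r *: u| = r by rewrite normrZ u1 mulr1 gtr0_norm.
pose g := r / k.
have k0 : 0 < k by rewrite divr_gt0.
have gk : g * k = r by rewrite /g divfK // gt_eqF.
have gs : - (2 * r * s) <= g.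
  rewrite -(ler_pM2r k0) gk /k mulrA ler_pdivrMr //.
  have := ler_wpM2l (ltW r0) th; lra.
(* Seen from [m], the ends of the arc are [- m] and [c - m]. *)
have ruE : r *: u = (g / 2 - r * s) *: (- m) + (g / 2 + r * s) *: (c - m).
  have -> : c - m = k *: e + 2^-1 *: c.
    rewrite opprB addrCA -[X in X - _]scale1r -scalerBl.
    by congr (_ + _ *: _); lra.
  have -> : - m = k *: e - 2^-1 *: c by rewrite opprB.
  have -> : u = e + s *: c by rewrite eE subrK.
  rewrite !scalerDr scalerN !scalerA -scaleNr addrACA.
  rewrite -(scalerDl e) -(scalerDl c).
  congr (_ *: _ + _ *: _); last by lra.
  by rewrite -{1}gk; field.
clearbody m.
have a0 : 0 <= g / 2 - r * s by have := mulr_ge0_le0 (ltW r0) s0; lra.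
have b0 : 0 <= g / 2 + r * s by lra.
exists (m + r *: u).
  have : 0 < '[m + r *: u, m + r *: u].
    rewrite dot_gt0 //; apply: contraTneq rc => mu0; rewrite -leNgt.
    by move/eqP: mu0; rewrite addrC addr_eq0 => /eqP ->; rewrite addrC cmr.
  have := sqr_norm (- m); rewrite mr !dotE uu (dotC m u) => mm mu0.
  rewrite mulr1 -(pmulr_rgt0 _ r0); lra.
move=> w wr wcr.
rewrite opprD addrA.
apply: (ball_hull_arc _ (- m) (c - m) _ _ _ _ r0 mr cmr rur ruE a0 b0).
  by rewrite opprK subrK.
by rewrite opprB subrKA.
Qed.
End Arc.

(** * Maximal sets and constant diameter *)

Section Maximal.
Context {R : realType} {E : euclideanType R}.
Implicit Types (u v w x y z c p : E) (A B C : set E) (r : R).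

Lemma r_boundedP r A :
  r_bounded r A <-> forall x y, A x -> A y -> `|x - y| <= r.
Proof.
split=> [rA x y Ax Ay|rA].
  rewrite -lee_fin; apply: le_trans rA; apply: ereal_sup_ubound.
  by exists (x, y).
apply: ge_ereal_sup => _ [[x y] [/= Ax Ay] <-].
by rewrite lee_fin rA.
Qed.

Lemma r_maximal_dist {r C} : r_maximal r C ->
  forall x y, C x -> C y -> `|x - y| <= r.
Proof. by case=> /r_boundedP. Qed.

Lemma r_maximal_mem {r C z} : 0 <= r -> r_maximal r C ->
  (forall c, C c -> `|c - z| <= r) -> C z.
Proof.
move=> r0 [/r_boundedP rC maxC] Cz.
rewrite -(maxC (C `|` [set z])); [by right | | by move=> c; left].
apply/r_boundedP => x y [Cx|->] [Cy|->]; first exact: rC.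
- exact: Cz.
- by rewrite distrC Cz.
- by rewrite subrr normr0.
Qed.

Lemma r_maximal_nonempty {r C} : 0 <= r -> r_maximal r C -> C !=set0.
Proof.
move=> r0 mC; apply/set0P/negP => /eqP C0.
suff : C 0 by rewrite C0.
by apply: (r_maximal_mem r0 mC) => c; rewrite C0.
Qed.

Lemma closure_normP A x :
  closure A x <-> forall e, 0 < e -> exists2 y, A y & `|x - y| < e.
Proof.
split=> [cA e e0|cA B /nbhs_normP [e /= e0 eB]].
  have [|y [Ay yx]] := cA (ball x e); first exact: nbhsx_ballx.
  by exists y => //; rewrite -ball_normE in yx.
by have [y Ay yx] := cA _ e0; exists y; split => //; exact: eB.
Qed.

Lemma r_maximal_closed {r C} : 0 <= r -> r_maximal r C -> closure C `<=` C.
Proof.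
move=> r0 mC z /closure_normP cz; apply: (r_maximal_mem r0 mC) => c Cc.
apply/ler_addgt0Pr => e /cz [y Cy zy].
have -> : c - z = (c - y) + (y - z) by rewrite subrKA.
rewrite (le_trans (ler_normD _ _)) // lerD ?(r_maximal_dist mC) //.
by rewrite distrC ltW.
Qed.

(** Moving [y] away from [x] leaves the set at once, by boundedness. *)
Lemma boundary_diametral {r C x y} : 0 < r -> r_bounded r C ->
  C x -> C y -> `|x - y| = r -> boundary C y.
Proof.
move=> r0 /r_boundedP rC Cx Cy xy; split; first exact: subset_closure.
move=> /nbhs_normP [e /= e0 eC].
have k0 : 0 < e / 2 / r by rewrite !divr_gt0.
have : C (y + (e / 2 / r) *: (y - x)).
  apply: eC => /=; rewrite opprD addrA subrr sub0r normrN normrZ distrC xy.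
  by rewrite gtr0_norm // divfK ?gt_eqF //; lra.
move=> /(rC _ _ Cx); rewrite opprD addrA -scalerN opprB.
rewrite -[X in X + _]scale1r -scalerDl normrZ xy gtr0_norm ?addr_gt0 //.
by rewrite mulrDl divfK ?gt_eqF //; lra.
Qed.

(** If all points of [C] were within [r - e] of [y], then the whole ball of
    radius [e] around [y] would be within [r] of them, hence in [C]. *)
Lemma not_interior_far {r C y} e : 0 <= r -> r_maximal r C -> 0 < e ->
  ~ (C°) y -> exists2 c, C c & r - e < `|c - y|.
Proof.
move=> r0 mC e0 Cy; apply: contra_notP Cy => near_y.
apply/nbhs_normP; exists e => //= z /= yz; apply: (r_maximal_mem r0 mC) => c Cc.
have cy : `|c - y| <= r - e.
  by rewrite leNgt; apply/negP => cy; apply: near_y; exists c.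
have -> : c - z = (c - y) + (y - z) by rewrite subrKA.
by rewrite (le_trans (ler_normD _ _)) //; lra.
Qed.

(** If [p - r u] were too far from a point [c] of [C], then [arc_bulge] would
    produce a point of [C] higher than [p]. *)
Lemma r_maximal_support {r C u p} : 0 < r -> r_maximal r C -> `|u| = 1 ->
  C p -> (forall c, C c -> '[u, c] <= '[u, p]) -> C (p - r *: u).
Proof.
move=> r0 mC u1 Cp up; apply: (r_maximal_mem (ltW r0) mC) => c Cc.
rewrite leNgt; apply/negP => far.
have [|||z uz hz] := arc_bulge r u (c - p) r0 u1.
- by rewrite !dotE subr_le0 up.
- exact: (r_maximal_dist mC).
- by move: far; rewrite opprB addrCA.
have : C (p + z).
  apply: (r_maximal_mem (ltW r0) mC) => w Cw; rewrite opprD addrA.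
  apply: hz; first exact: (r_maximal_dist mC).
  by rewrite opprB subrKA (r_maximal_dist mC).
by move/up; rewrite !dotE; lra.
Qed.

Lemma continuous_dotp u : continuous (fun x => '[u, x] : R).
Proof.
have polarization : (fun x => '[u, x] : R) =
    (fun x => (`|x + u| * `|x + u| - `|x - u| * `|x - u|) * 4^-1).
  by apply/funext => x; rewrite -!expr2 !sqr_norm !dotE (dotC x u); lra.
rewrite polarization => x; apply: cvgM; last exact: cvg_cst.
apply: cvgB; apply: cvgM; apply: cvg_norm; do ?[apply: cvgD | apply: cvgB];
  by [exact: cvg_id|exact: cvg_cst].
Qed.

Lemma r_maximal_constant_diameter {r C} : 0 < r -> compact C ->
  r_maximal r C -> constant_diameter r C.
Proof.
move=> r0 cC mC omega omega1.
have [u omegaE] := riesz omega.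
have u1 : `|u| = 1.
  by move: omega1; rewrite (dual_norm_dot _ _ omegaE) => -[].
apply/eqP; rewrite eq_le; apply/andP; split.
  apply: ge_ereal_sup => _ [[x y] [/= Cx Cy] <-]; rewrite lee_fin omegaE.
  rewrite (le_trans (dot_le_norm _ _)) // u1 mul1r.
  exact: (r_maximal_dist mC).
have [p pC up] := compact_EVT_max (r_maximal_nonempty (ltW r0) mC) cC
  (continuous_subspaceT (continuous_dotp u)).
rewrite inE in pC; apply: ereal_sup_ubound; exists (p, p - r *: u) => /=.
  split=> //; apply: (r_maximal_support r0 mC u1 pC) => c Cc.
  by apply: up; rewrite inE.
by rewrite omegaE !dotE -sqr_norm u1; congr EFin; ring.
Qed.

Lemma nearest_point {C b} : compact C ->
  convex_set (C : set (convex_lmodType E)) -> C !=set0 ->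
  exists2 p, C p & forall c, C c -> '[b - p, c - p] <= 0.
Proof.
move=> cC convC C0.
have contd : continuous (fun x : E => `|b - x| : R).
  move=> x; apply: cvg_norm; apply: cvgB; [exact: cvg_cst|exact: cvg_id].
have [p pC minp] := compact_EVT_min C0 cC (continuous_subspaceT contd).
rewrite inE in pC; exists p => // c Cc; rewrite leNgt; apply/negP => D0.
have step t : 0 <= t -> t <= 1 -> 2 * t * '[b - p, c - p] <=
    t ^+ 2 * '[c - p, c - p].
  move=> t0 t1.
  have Ct : C (t *: c + (1 - t) *: p).
    have := convC c p (Itv01 t0 t1); rewrite !inE => /(_ Cc pC).
    by rewrite /conv.
  have /minp : (t *: c + (1 - t) *: p) \in C by rewrite inE.
  rewrite norm_le_dot // sqr_norm.
  have -> : b - (t *: c + (1 - t) *: p) = (b - p) - t *: (c - p).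
    rewrite scalerBl scale1r scalerBr -[RHS]addrA -opprD; congr (b - _).
    exact: addrCA.
  move: (b - p) (c - p) => d e; rewrite !dotE (dotC e d); lra.
(* The case [t = 1] makes [t] below, the minimizer of the quadratic
   [t^2 |c - p|^2 - 2 t <b - p, c - p>], lie in the unit interval. *)
have D1 := step _ ler01 (lexx 1).
have G0 : 0 < '[c - p, c - p] by lra.
pose t := '[b - p, c - p] / '[c - p, c - p].
have tG : t * '[c - p, c - p] = '[b - p, c - p] by rewrite divfK // gt_eqF.
have t0 : 0 < t by rewrite divr_gt0.
have t1 : t <= 1 by rewrite ler_pdivrMr //; lra.
have := step _ (ltW t0) t1; rewrite expr2 -[t * t * _]mulrA tG.
have := mulr_gt0 t0 D0; lra.
Qed.

Lemma constant_diameter_dist {r C} : constant_diameter r C -> 0 < r ->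
  forall x y, C x -> C y -> `|x - y| <= r.
Proof.
move=> wC r0 x y Cx Cy; have [->|xy] := eqVneq x y.
  by rewrite subrr normr0 ltW.
have n0 : 0 < `|x - y| by rewrite normr_gt0 subr_eq0.
pose u := `|x - y|^-1 *: (x - y).
have u1 : `|u| = 1.
  by rewrite normrZ normfV normr_id mulVf ?gt_eqF.
have := wC (dotp u : {linear E -> R^o}).
rewrite -lee_fin (dual_norm_dot _ u) // u1 => /(_ erefl) <-.
apply: ereal_sup_ubound; exists (x, y) => //=.
by rewrite dotZl -sqr_norm expr2 mulrA mulVf ?gt_eqF ?mul1r.
Qed.

(** A nonzero vector is needed to exclude [C = set0]: in dimension [0] there is
    no unit linear form, and the empty set has constant diameter. *)
Lemma constant_diameter_r_maximal {r C} : (0 < \dim {:E})%N -> 0 < r ->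
  compact C -> convex_set (C : set (convex_lmodType E)) ->
  constant_diameter r C -> r_maximal r C.
Proof.
move=> dimE r0 cC convC wC.
have attained u e : `|u| = 1 -> 0 < e -> exists x y,
    [/\ C x, C y & r - e < '[u, x - y]].
  move=> u1 e0; have := wC (dotp u : {linear E -> R^o}).
  rewrite (dual_norm_dot _ u) // u1 => /(_ erefl) supC.
  have [|_ [[x y] [/= Cx Cy] <-]] := @ereal_sup_gt _
    [set (dotp u (p.1 - p.2))%:E | p in C `*` C] (r - e)%:E.
    by rewrite supC lte_fin; lra.
  by rewrite lte_fin; exists x, y.
have C0 : C !=set0.
  have v0 : vpick {:E} != 0 by rewrite vpick0 -dimv_eq0 -lt0n.
  have [|x [y [Cx _ _]]] := attained (`|vpick {:E}|^-1 *: vpick {:E}) 1 _ ltr01.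
    by rewrite normrZ normfV normr_id mulVf ?normr_eq0.
  by exists x.
split; first exact/r_boundedP/constant_diameter_dist.
move=> B /r_boundedP rB CB; apply/seteqP; split=> // b Bb.
have [p Cp hp] := nearest_point (b := b) cC convC C0.
have [->//|bp] := eqVneq b p; exfalso.
have n0 : 0 < `|b - p| by rewrite normr_gt0 subr_eq0.
have [|x [y [Cx Cy xy]]] := attained (`|b - p|^-1 *: (b - p)) _ _ n0.
  by rewrite normrZ normfV normr_id mulVf ?gt_eqF.
have : r * `|b - p| < '[b - p, b - y].
  have -> : b - y = (b - p) + ((x - y) - (x - p)).
    by rewrite opprB [X in _ = _ + X]addrC !subrKA.
  rewrite (dotDr _ (b - p)) (dotDr _ (x - y)) dotNr -sqr_norm.
  move: xy; rewrite dotZl mulrC ltr_pdivlMr // => xy.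
  have := hp _ Cx; lra.
have := dot_le_norm (b - p) (b - y).
have := ler_wpM2l (ltW n0) (rB _ _ Bb (CB _ Cy)); lra.
Qed.
End Maximal.

(** * Arcs in the boundary of a maximal set *)

Section ArcGeometry.
Context {R : realType} {E : euclideanType R}.
Implicit Types (u v x y z : E) (A C : set E) (r t theta : R).

Lemma circle_point_radius x r u v t : 0 < r ->
  '[u, u] = 1 -> '[v, v] = 1 -> '[u, v] = 0 ->
  `|circle_point x r u v t - x| = r.
Proof.
move=> r0 uu vv uv; apply: norm_eq_dot; first exact: ltW.
rewrite /circle_point addrC addKr !dotE uu vv (dotC v u) uv.
have := cos2Dsin2 t; move: (cos t) (sin t) => c s cs.
by rewrite -[RHS]mulr1 -[X in _ = _ * X]cs; ring.
Qed.

Lemma arc_radius {x r y1 y2 A y} : 0 < r -> is_arc x r y1 y2 A -> A y ->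
  `|y - x| = r.
Proof.
move=> r0 [u [v [th [[uu vv uv] _ _ _ ->]]]] [t _ <-].
exact: circle_point_radius.
Qed.

Lemma arc_ends {x r y1 y2 A} : is_arc x r y1 y2 A -> A y1 /\ A y2.
Proof.
move=> [u [v [th [_ /andP [th0 _] -> -> ->]]]].
by split; [exists 0|exists th] => //=; rewrite in_itv /= lexx ltW.
Qed.

Lemma arc_inner_point {x r y1 y2 A} : 0 < r -> is_arc x r y1 y2 A ->
  exists y, [/\ A y, y != y1 & y != y2].
Proof.
move=> r0 [u [v [th [[uu vv uv] /andP [th0 thpi] -> -> ->]]]].
have cos_dot t : '[u, circle_point x r u v t - x] = r * cos t.
  by rewrite /circle_point [x + _]addrC addrK !dotE uu uv; ring.
have inj s t : 0 <= s <= pi -> 0 <= t <= pi ->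
    circle_point x r u v s = circle_point x r u v t -> s = t.
  move=> hs ht st; apply: cos_inj; rewrite ?in_itv //.
  by apply: (mulfI (lt0r_neq0 r0)); rewrite -!cos_dot st.
have h0 : 0 <= (0 : R) <= pi by rewrite lexx pi_ge0.
have h1 : 0 <= th / 2 <= pi by apply/andP; split; lra.
have h2 : 0 <= th <= pi by apply/andP; split; lra.
exists (circle_point x r u v (th / 2)); split.
- by exists (th / 2) => //=; rewrite in_itv /=; apply/andP; split; lra.
- by apply/eqP => /(inj _ _ h1 h0); lra.
- by apply/eqP => /(inj _ _ h1 h2); lra.
Qed.

(** The bound on [|y1 - y2|] excludes semicircles, whose ends are opposite seen
    from the center, so that [y1 - x] and [y2 - x] do not span the plane of the
    arc. *)
Lemma arc_cone {x r y1 y2 A y} : 0 < r -> is_arc x r y1 y2 A ->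
  `|y1 - y2| <= r -> A y -> exists a b, [/\ 0 <= a, 0 <= b,
    y - x = a *: (y1 - x) + b *: (y2 - x) &
    y != y1 -> y != y2 -> 0 < a /\ 0 < b].
Proof.
move=> r0 [u [v [th [[uu vv uv] /andP [th0 thpi] -> -> ->]]]] y12.
have thpi' : th < pi.
  rewrite lt_neqAle; apply/andP; split; last by lra.
  apply: contraTneq y12 => ->; rewrite -ltNge /circle_point.
  rewrite opprD addrACA subrr add0r -scalerBr normrZ gtr0_norm //.
  rewrite cos0 sin0 cospi sinpi !scale0r !addr0 scaleN1r scale1r opprK.
  have -> : `|u + u| = 2.
    by apply: norm_eq_dot => //; rewrite !dotE uu; ring.
  lra.
have sth : 0 < sin th by rewrite sin_gt0_pi // th0.
move=> [t /=]; rewrite in_itv /= => /andP [t0 tth] <-.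
exists (sin (th - t) / sin th), (sin t / sin th); split.
- by rewrite divr_ge0 ?(ltW sth) // sin_ge0_pi //; apply/andP; split; lra.
- by rewrite divr_ge0 ?(ltW sth) // sin_ge0_pi //; apply/andP; split; lra.
- rewrite /circle_point ![x + _ - x]addrAC !subrr !add0r cos0 sin0.
  have swap k w : k *: (r *: w) = r *: (k *: w) by rewrite !scalerA mulrC.
  rewrite scale0r addr0 scale1r !swap -scalerDr; congr (_ *: _).
  rewrite [(sin t / _) *: _]scalerDr !scalerA addrA -scalerDl.
  congr (_ *: _ + _ *: _).
    by rewrite sinB; field; rewrite gt_eqF.
  by rewrite divfK // gt_eqF.
move=> yy1 yy2; split; rewrite divr_gt0 // sin_gt0_pi //; apply/andP; split.
- by rewrite subr_gt0 lt_neqAle tth andbT; apply: contraNneq yy2 => ->.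
- lra.
- by rewrite lt_neqAle t0 andbT; apply: contraNneq yy1 => <-.
- lra.
Qed.

Lemma arc_sub_boundary {r C x y1 y2 A} : 0 < r -> r_maximal r C ->
  C x -> C y1 -> C y2 -> is_arc x r y1 y2 A -> A `<=` boundary C.
Proof.
move=> r0 mC Cx Cy1 Cy2 arcA y Ay.
have [A1 A2] := arc_ends arcA.
have [a [b [a0 b0 yE _]]] :=
  arc_cone r0 arcA (r_maximal_dist mC _ _ Cy1 Cy2) Ay.
apply: (boundary_diametral r0 mC.1 Cx); last first.
  by rewrite distrC (arc_radius r0 arcA).
apply: (r_maximal_mem (ltW r0) mC) => c Cc.
have h z : (c - x) - (z - x) = c - z by rewrite opprB subrKA.
rewrite -h; apply: (ball_hull_arc _ _ _ _ _ _ _ r0 _ _ _ yE a0 b0);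
  rewrite ?h ?(arc_radius r0 arcA) //; exact: (r_maximal_dist mC).
Qed.

(** Both parts of the conclusion come from [key], the form of [arc_dist] at an
    inner point [y]: a point of [C] almost at distance [r] from [y] is close to
    [x], and one exactly at distance [r] is [x]. *)
Lemma boundary_arc_center {r C x y1 y2 A} : 0 < r -> r_maximal r C ->
  y1 != y2 -> is_arc x r y1 y2 A -> A `<=` boundary C ->
  boundary C x /\ forall y, A y -> y != y1 -> y != y2 ->
    [set z | C z /\ `|z - y| = r] = [set x].
Proof.
move=> r0 mC y12 arcA AC.
have r0' := ltW r0.
have subC y : A y -> C y by move/AC => [/(r_maximal_closed r0' mC)].
have [A1 A2] := arc_ends arcA.
have rad y : A y -> `|y - x| = r := arc_radius r0 arcA.
have key y : A y -> y != y1 -> y != y2 -> exists2 d, 0 < d &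
    forall z, C z -> `|z - y| ^+ 2 + d * `|z - x| ^+ 2 <= r ^+ 2.
  move=> Ay yy1 yy2.
  have [a [b [a0 b0 yE ab0]]] :=
    arc_cone r0 arcA (r_maximal_dist mC _ _ (subC _ A1) (subC _ A2)) Ay.
  have [a0' b0'] := ab0 yy1 yy2.
  exists (a + b - 1).
    rewrite subr_gt0.
    apply: (arc_coef_gt1 _ _ _ _ _ _ r0
      (rad _ A1) (rad _ A2) (rad _ Ay) yE) => //.
    by rewrite (inj_eq (addIr _)).
  move=> z Cz; have h w : (z - x) - (w - x) = z - w by rewrite opprB subrKA.
  rewrite -(h y).
  apply: (arc_dist _ _ _ _ _ _ _ (rad _ A1) (rad _ A2) (rad _ Ay) yE) => //;
    rewrite h; apply: (r_maximal_dist mC) => //; exact: subC.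
have Cx : C x.
  have [y [Ay yy1 yy2]] := arc_inner_point r0 arcA.
  have [d d0 dist_y] := key _ Ay yy1 yy2.
  apply: (r_maximal_closed r0' mC); apply/closure_normP => e e0.
  (* A point [c] of [C] with [|c - y| > r - e'] satisfies
     [d |c - x|^2 < r^2 - (r - e')^2 <= 2 r e'], which is to be at most
     [d e^2]. *)
  pose e' := Num.min r (d * e ^+ 2 / (2 * r)).
  have de0 : 0 < d * e ^+ 2 / (2 * r) by rewrite divr_gt0 ?mulr_gt0 ?exprn_gt0.
  have e'0 : 0 < e' by rewrite lt_min r0 de0.
  have e'r : e' <= r by rewrite ge_min lexx.
  have e'd : 2 * r * e' <= d * e ^+ 2.
    by rewrite mulrC -ler_pdivlMr ?mulr_gt0 // ge_min lexx orbT.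
  have [c Cc far] := not_interior_far e' r0' mC e'0 (AC _ Ay).2.
  exists c => //; rewrite distrC -ltr_sqr ?nnegrE ?(ltW e0) // -(ltr_pM2l d0).
  have := dist_y _ Cc.
  have : (r - e') ^+ 2 < `|c - y| ^+ 2 by rewrite ltr_sqr ?nnegrE ?subr_ge0.
  have := exprn_gt0 2 e'0; rewrite sqrrB; lra.
split.
  exact: (boundary_diametral r0 mC.1 (subC _ A1) Cx (rad _ A1)).
move=> y Ay yy1 yy2; have [d d0 dist_y] := key _ Ay yy1 yy2.
apply/seteqP; split=> [z [Cz zy]|_ ->] /=; last by rewrite distrC rad.
have := dist_y _ Cz; rewrite zy gerDl pmulr_rle0 // => zx.
apply/eqP; rewrite -subr_eq0 -normr_eq0 -sqrf_eq0 eq_le zx.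
exact: sqr_ge0.
Qed.
End ArcGeometry.

Theorem theorem0p3 (R : realType) (E : euclideanType R) (r : R)
    (dimE : (2 <= \dim {:E})%N) (r_gt0 : 0 < r) :
  (forall C : set E, compact C -> convex_set (C : set (convex_lmodType E)) ->
     r_maximal r C <-> constant_diameter r C)
  /\
  (forall C : set E, r_maximal r C ->
     (forall x y1 y2 : E, C x -> C y1 -> C y2 -> y1 != y2 ->
        `|x - y1| = r -> `|x - y2| = r ->
        forall A : set E, is_arc x r y1 y2 A -> A `<=` boundary C)
     /\
     (forall (x y1 y2 : E) (A : set E), y1 != y2 ->
        is_arc x r y1 y2 A -> A `<=` boundary C ->
        boundary C x /\
        forall y : E, A y -> y != y1 -> y != y2 ->
          [set z | C z /\ `|z - y| = r] = [set x])).
Proof.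
split=> [C cC convC|C mC]; split.
- exact: r_maximal_constant_diameter.
- by apply: constant_diameter_r_maximal => //; exact: ltnW.
- by move=> x y1 y2 Cx Cy1 Cy2 _ _ _ A; exact: arc_sub_boundary.
- by move=> x y1 y2 A; exact: boundary_arc_center.
Qed.
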